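(* Let $X_1,X_2,\ldots$ be i.i.d. random variables having a geometric distribution with mean $\theta\in(1,\infty)$. Let $\varepsilon,\delta\in(0,1)$, let $s$ be a positive integer, let $m_1<m_2<\cdots<m_s$ be positive integers with $$m_s\ge\frac{(1+\varepsilon)\ln\frac{2s}{\delta}}{(1+\varepsilon)\ln(1+\varepsilon)-\varepsilon},$$ and let $\mathcal N$ be a set of positive integers containing $\{m_1,\ldots,m_s\}$. Let $\overline{X}_n=\frac1n\sum_{i=1}^nX_i$. Let $\mathbf n$ be the smallest $n\in\mathcal N$ for which there exists $\ell\in\{1,\ldots,s\}$ with $$M_{\mathrm G}\left(\left(1+\varepsilon-\frac{n\varepsilon}{n\vee m_\ell}\right)\overline{X}_n,\ (1+\varepsilon)\overline{X}_n\right)\le\frac1{m_\ell}\ln\frac{\delta}{2s}.$$ Then $\Pr\{(1-\varepsilon)\overline{X}_{\mathbf n}<\theta<(1+\varepsilon)\overline{X}_{\mathbf n}\}\ge1-\delta$.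
   Context: $a\vee b$ denotes $\max(a,b)$. The geometric distribution with mean $\theta$ is supported on $\{1,2,3,\ldots\}$ with $\Pr\{X=k\}=\frac1\theta(1-\frac1\theta)^{k-1}$. The function $M_{\mathrm G}$ is defined by: $M_{\mathrm G}(z,\vartheta)=z\ln\frac{\vartheta'}{}$-free formula $M_{\mathrm G}(z,\vartheta)=-z\ln\frac{\vartheta}{z}+(1-z)\ln\frac{1-z}{1-\vartheta}$, i.e. $z\ln\frac{z}{\vartheta}+(1-z)\ln\frac{1-z}{1-\vartheta}$, for $z\in(1,\infty)$, $\vartheta\in(1,\infty)$; $M_{\mathrm G}(1,\vartheta)=-\ln\vartheta$ for $\vartheta\in(1,\infty)$; $M_{\mathrm G}(z,\vartheta)=-\infty$ for $z\in[1,\infty)$ and $\vartheta\notin(1,\infty)$. *)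

(* Defs.v *)
From HB Require Import structures.
From mathcomp Require Import all_boot all_order all_algebra.
From mathcomp Require Import all_classical all_reals all_analysis.
Set Implicit Arguments.
Unset Strict Implicit.
Unset Printing Implicit Defensive.
Import Order.TTheory GRing.Theory Num.Theory.
Import numFieldNormedType.Exports.
Open Scope classical_set_scope.
Open Scope ring_scope.

(* Meant for z >= 1; for z < 1 and v > 1, which the mathematical definition
   does not cover, the value is irrelevant. *)
Definition M_G (R : realType) (z v : R) : \bar R :=
  if ~~ (1 < v) then -oo%E
  else if z == 1 then (- ln v)%:E
  else (z * ln (z / v) + (1 - z) * ln ((1 - z) / (1 - v)))%:E.

(* The masses at 1, 2, 3, ... add up to 1 when theta > 1, so the support
   condition is a consequence. *)
Definition geometric_law (d : measure_display) (T : measurableType d)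
    (R : realType) (P : probability T R) (theta : R) (X : T -> R) : Prop :=
  forall k : nat, (0 < k)%N ->
    P [set w | X w = k%:R] = (theta^-1 * (1 - theta^-1) ^+ (k - 1))%:E.

Definition mutually_independent (d : measure_display) (T : measurableType d)
    (R : realType) (P : probability T R) (X : nat -> T -> R) : Prop :=
  forall (J : seq nat) (B : nat -> set R), uniq J ->
    (forall i, measurable (B i)) ->
    P (\big[setI/setT]_(i <- J) (X i @^-1` B i)) =
    (\prod_(i <- J) P (X i @^-1` B i))%E.

(* X i plays the role of X_{i+1}. *)
Definition sample_mean (T : Type) (R : realType) (X : nat -> T -> R)
    (n : nat) (w : T) : R :=
  n%:R^-1 * \sum_(i < n) X i w.

Definition stop_cond (R : realType) (eps delta : R) (s : nat) (m : nat -> nat)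
    (n : nat) (x : R) : Prop :=
  exists l : nat, (1 <= l <= s)%N /\
    (M_G ((1 + eps - n%:R * eps / (maxn n (m l))%:R) * x) ((1 + eps) * x)
     <= ((m l)%:R^-1 * ln (delta / (2 * s%:R)))%:E)%E.

(* The default value 0 is used when no n in N satisfies the stopping condition.
   As sample_mean X 0 w = 0, such a w is not in the event
   (1 - eps) * mean < theta < (1 + eps) * mean when theta > 0. *)
Definition stopping_time (T : Type) (R : realType) (X : nat -> T -> R)
    (eps delta : R) (s : nat) (m : nat -> nat) (N : set nat) (w : T) : nat :=
  xget 0%N [set n : nat |
    [/\ N n,
        stop_cond eps delta s m n (sample_mean X n w) &
        forall k, N k -> stop_cond eps delta s m k (sample_mean X k w) ->
          (n <= k)%N]].

(* Main.v *)
Require Import Defs.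
From HB Require Import structures.
From mathcomp Require Import all_boot all_order all_algebra.
From mathcomp Require Import all_classical all_reals all_analysis.
From mathcomp Require Import measurable_realfun.
From mathcomp Require Import ring lra.
Import Order.TTheory GRing.Theory Num.Theory.
Import numFieldNormedType.Exports.
Local Open Scope classical_set_scope.
Local Open Scope ring_scope.

(** Write [I(z, v) = - M_G(z, v)] for the large deviation rate of the geometric
    law of mean [v].  If the procedure stops at [n] through the index [l] while
    [theta] is at least [(1 + eps) * Xbar_n], or at most [(1 - eps) * Xbar_n],
    complete the [n] observations with copies of [theta] to
    [n' = maxn n (m l)] values: their mean [w] then satisfies
    [I(w, theta) >= ln (2s / delta) / m l].  So [w] lies beyond the extreme point
    [z] of that level set, which does not depend on [n], and this forces the
    likelihood ratio of the geometric law of mean [z] against the one of mean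
    [theta] to be at least [2s / delta] at time [n].  By Ville's inequality this
    ever happens with probability at most [delta / (2s)]; a union bound over [l]
    and the two sides gives [delta].  The lower bound on [m s] makes the
    procedure stop at [m s] at the latest. *)

(** * Rate function of the geometric laws: convexity and comparison inequalities *)

Section RateFunction.
Variable R : realType.
Implicit Types (a b c k m v w x z theta eps : R).

Lemma nondecreasing_is_derive (f df : R -> R) a b : a <= b ->
  (forall x, a <= x <= b -> is_derive x 1 f (df x)) ->
  (forall x, a <= x <= b -> 0 <= df x) -> f a <= f b.
Proof.
move=> ab fdf df0.
have [||x xab fab] := @MVT_segment R f df a b ab.
- by move=> x xab; apply: fdf; move: xab; rewrite in_itv/= => /andP[/ltW-> /ltW->].
- apply: derivable_within_continuous => x; rewrite in_itv/= => xab.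
  by have [] := fdf x xab.
- by rewrite -subr_ge0 fab mulr_ge0 ?subr_ge0// df0; move: xab; rewrite in_itv.
Qed.

(** Along an affine path each term of the rate is an affine function times the logarithm of an
    affine function, so this formula yields the derivatives of both comparison functions below. *)
Lemma is_derive_affine_mul_ln (p q a b x : R) : 0 < a + b * x ->
  is_derive x 1 (fun y => (p + q * y) * ln (a + b * y))
    (q * ln (a + b * x) + (p + q * x) * b / (a + b * x)).
Proof.
move=> abx0.
have aff (u v : R) : is_derive x 1 (fun y => u + v * y) v.
  by apply: is_derive_eq; rewrite /GRing.scale/=; ring.
have dln : is_derive x 1 (fun y => ln (a + b * y)) (b / (a + b * x)).
  have -> : (fun y => ln (a + b * y)) = @ln R \o (fun y => a + b * y) by [].
  rewrite mulrC.
  apply: (@is_derive1_comp R (@ln R) (fun y => a + b * y) x (a + b * x)^-1 b).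
  exact: is_derive1_ln.
by apply: is_derive_eq; rewrite /GRing.scale/=; ring.
Qed.

(** This is the Kullback-Leibler divergence of the geometric law of mean [z] from the one of mean
    [v]. Keeping the logarithms apart makes identities linear in them, and [(z - 1) * ln (z - 1)]
    vanishes at [z = 1], which absorbs the separate case of [M_G]. *)
Definition geom_rate z v : R :=
  z * ln v + (z - 1) * ln (z - 1) - z * ln z - (z - 1) * ln (v - 1).

(** The partial derivative of [geom_rate z v] in [z]. *)
Definition geom_slope z v : R := ln v + ln (z - 1) - ln z - ln (v - 1).

Lemma M_G_rate z v : 1 <= z -> 1 < v -> M_G z v = (- geom_rate z v)%:E.
Proof.
move=> z1 v1; rewrite /M_G v1/= /geom_rate.
have [->|zn1] := eqVneq z 1; first by rewrite subrr !mul0r ln1 mulr0 mul1r !subr0 addr0.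
have {zn1}z1 : 1 < z by rewrite lt_neqAle eq_sym zn1.
congr EFin.
have -> : (1 - z) / (1 - v) = (z - 1) / (v - 1).
  by field; rewrite subr_eq0 gt_eqF//= subr_eq0 lt_eqF.
by rewrite !ln_div ?posrE ?subr_gt0 ?(lt_trans ltr01 z1) ?(lt_trans ltr01 v1)//; ring.
Qed.

Lemma ln_le_subr1 x : 0 < x -> ln x <= x - 1.
Proof. by move=> x0; rewrite -{1}(subrKC 1 x) le_ln1Dx//; lra. Qed.

(** Gibbs' inequality: [ln u <= u - 1] is applied to the ratio of the failure probabilities and to
    that of the success probabilities, and the two weighted upper bounds add up to 0. *)
Lemma geom_rate_ge0 z v : 1 <= z -> 1 < v -> 0 <= geom_rate z v.
Proof.
move=> z1 v1; have v0 : 0 < v by lra.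
have v10 : 0 < v - 1 by lra.
rewrite /geom_rate; have [->|zn1] := eqVneq z 1.
  by rewrite subrr !mul0r ln1 mulr0 mul1r !subr0 addr0 ln_ge0// ltW.
have z10 : 0 < z - 1 by rewrite subr_gt0 lt_neqAle eq_sym zn1.
have z0 : 0 < z by lra.
have h1 : (z - 1) * ln (z * (v - 1) / (v * (z - 1))) <=
          (z - 1) * (z * (v - 1) / (v * (z - 1)) - 1).
  by rewrite ler_pM2l// ln_le_subr1// divr_gt0 ?mulr_gt0.
have h2 : ln (z / v) <= z / v - 1 by rewrite ln_le_subr1// divr_gt0.
have e : (z - 1) * (z * (v - 1) / (v * (z - 1)) - 1) + (z / v - 1) = 0.
  by field; rewrite !gt_eqF.
move: h1 h2; rewrite !ln_div ?lnM ?posrE ?mulr_gt0// => h1 h2.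
by rewrite -e in h1 h2 *; nra.
Qed.

(** The remainder of the first-order expansion in the first argument is again a rate, hence
    nonnegative: this carries the convexity of the rate. *)
Lemma geom_rate_tangent w z v :
  geom_rate w v = geom_rate z v + geom_slope z v * (w - z) + geom_rate w z.
Proof. by rewrite /geom_rate /geom_slope; ring. Qed.

Lemma geom_rate_diag v : geom_rate v v = 0.
Proof. by rewrite /geom_rate; ring. Qed.

Lemma geom_slope_ge0 z v : 1 < v -> v <= z -> 0 <= geom_slope z v.
Proof.
move=> v1 vz; rewrite /geom_slope.
have : ln (z * (v - 1)) <= ln (v * (z - 1)).
  by rewrite ler_ln ?posrE ?mulr_gt0//; nra.
by rewrite !lnM ?posrE//; lra.
Qed.

(** The slope is antisymmetric in its two arguments. *)
Lemma geom_slope_le0 z v : 1 < z -> z <= v -> geom_slope z v <= 0.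
Proof.
move=> v1 vz; have := @geom_slope_ge0 v z v1 vz; rewrite /geom_slope; lra.
Qed.

(** The graph lies above its tangent at [z], whose slope is nonnegative to the right of [v]. *)
Lemma geom_rate_nondecreasing v w z : 1 < v -> v <= z -> z <= w ->
  geom_rate z v <= geom_rate w v.
Proof.
move=> v1 vz zw; rewrite (geom_rate_tangent w z v).
have h1 := @geom_slope_ge0 z v v1 vz.
have h2 : 0 <= geom_rate w z by apply: geom_rate_ge0; lra.
by have := mulr_ge0 h1 (_ : 0 <= w - z); lra.
Qed.

(* The variance function [v * (v - 1)] increases, so the rate is larger when
   the deviation [k] is taken around the smaller mean. *)
Lemma geom_rate_deviation_le theta v k : 1 < theta -> 0 <= k ->
  theta + k <= v -> 1 < v - k ->
  geom_rate (v - k) v <= geom_rate (theta + k) theta.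
Proof.
move=> th1 k0 thk vk; rewrite -subr_ge0.
pose F y := geom_rate (theta + y) theta - geom_rate (v - y) v.
have -> : 0 = F 0 by rewrite /F !(addr0, subr0) !geom_rate_diag subrr.
rewrite -[leRHS]/(F k); apply: (@nondecreasing_is_derive F
  (fun y => geom_slope (theta + y) theta + geom_slope (v - y) v) 0 k k0).
  move=> y /andP[y0 yk].
  (* The factors [0 * y] and [1 * y] give all eight terms the shape required by
     [is_derive_affine_mul_ln]. *)
  have -> : F = fun y =>
    ((theta + 1 * y) * ln (theta + 0 * y) +
     (theta - 1 + 1 * y) * ln (theta - 1 + 1 * y) -
     (theta + 1 * y) * ln (theta + 1 * y) -
     (theta - 1 + 1 * y) * ln (theta - 1 + 0 * y)) -
    ((v + (- 1) * y) * ln (v + 0 * y) +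
     (v - 1 + (- 1) * y) * ln (v - 1 + (- 1) * y) -
     (v + (- 1) * y) * ln (v + (- 1) * y) -
     (v - 1 + (- 1) * y) * ln (v - 1 + 0 * y)).
    apply/funext => u; rewrite /F /geom_rate !mul0r !addr0 !mul1r !mulN1r.
    by rewrite !(addrAC _ (-1) u) !(addrAC _ (-1) (- u)).
  have p1 : 0 < theta + 0 * y by lra.
  have p2 : 0 < theta - 1 + 1 * y by lra.
  have p3 : 0 < theta + 1 * y by lra.
  have p4 : 0 < theta - 1 + 0 * y by lra.
  have p5 : 0 < v + 0 * y by lra.
  have p6 : 0 < v - 1 + (- 1) * y by lra.
  have p7 : 0 < v + (- 1) * y by lra.
  have p8 : 0 < v - 1 + 0 * y by lra.
  have d1 := @is_derive_affine_mul_ln theta 1 _ _ _ p1.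
  have d2 := @is_derive_affine_mul_ln (theta - 1) 1 _ _ _ p2.
  have d3 := @is_derive_affine_mul_ln theta 1 _ _ _ p3.
  have d4 := @is_derive_affine_mul_ln (theta - 1) 1 _ _ _ p4.
  have d5 := @is_derive_affine_mul_ln v (-1) _ _ _ p5.
  have d6 := @is_derive_affine_mul_ln (v - 1) (-1) _ _ _ p6.
  have d7 := @is_derive_affine_mul_ln v (-1) _ _ _ p7.
  have d8 := @is_derive_affine_mul_ln (v - 1) (-1) _ _ _ p8.
  apply: (is_derive_eq (is_deriveB
    (is_deriveB (is_deriveB (is_deriveD d1 d2) d3) d4)
    (is_deriveB (is_deriveB (is_deriveD d5 d6) d7) d8))).
  rewrite /geom_slope.
  rewrite -(mulrA _ 1 (_^-1)) -(mulrA _ (-1) (_^-1)).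
  rewrite !mulr0 !mul0r !addr0 !mul1r !mulN1r !mulr1 !mulrN1.
  rewrite !(mulNr, mulrN) !(addrAC _ (-1) y) !(addrAC _ (-1) (- y)).
  rewrite !divff ?gt_eqF//; try lra.
move=> y /andP[y0 yk]; rewrite /geom_slope.
set s1 := ln theta; set s2 := ln (theta + y).
(* The sum of the two slopes is the right logarithm minus the left one. The difference of the
   arguments factors through [y], and its sign follows from [theta + y <= v]. *)
have : ln (((theta + y) * (theta - 1)) * ((v - y) * (v - 1))) <=
       ln ((theta * (theta + y - 1)) * (v * (v - y - 1))).
  have p1 : 0 < theta - 1 by lra.
  have p2 : 0 < v - y - 1 by lra.
  rewrite ler_ln ?posrE ?mulr_gt0//; try lra.
  rewrite -subr_ge0.
  have -> : theta * (theta + y - 1) * (v * (v - y - 1)) -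
    (theta + y) * (theta - 1) * ((v - y) * (v - 1)) =
    y * (v * (v - y - 1) - (theta + y) * (theta - 1)) by ring.
  by rewrite mulr_ge0// subr_ge0 ler_pM//; lra.
by rewrite !lnM ?posrE ?mulr_gt0//; rewrite -/s1 -/s2; lra.
Qed.

(* The derivative in [v] is nonnegative because [ln (1 + u) <= u]. *)
Lemma geom_rate_interpolation_le c x v theta : 0 < c <= 1 -> 1 <= x ->
  x < v -> v <= theta ->
  geom_rate (c * x + (1 - c) * v) v <=
  geom_rate (c * x + (1 - c) * theta) theta.
Proof.
move=> /andP[c0 c1] x1 xv vth.
(* In this corner the first argument of the rate stays at 1, where [ln (z - 1)] is not
   differentiable; the rate is then just the logarithm of the mean. *)
have [/andP[/eqP-> /eqP->]|nc] := boolP ((c == 1) && (x == 1)).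
  rewrite !subrr !mul1r !mul0r !addr0 /geom_rate subrr !mul0r ln1 mulr0 !mul1r.
  by rewrite !subr0 !addr0 ler_ln// posrE; lra.
have zgt1 y : v <= y -> 1 < c * x + (1 - c) * y.
  move=> vy; move: nc; rewrite negb_and => /orP[] nc.
    have : c < 1 by rewrite lt_neqAle nc.
    by nra.
  have : 1 < x by rewrite lt_neqAle eq_sym nc.
  by nra.
pose G y := geom_rate (c * x + (1 - c) * y) y.
rewrite -[leLHS]/(G v) -[leRHS]/(G theta).
(* The second summand is the partial derivative of the rate in its second argument,
   [(y - z) / (y * (y - 1))], with [y - z = c * (y - x)]. *)
apply: (@nondecreasing_is_derive G
  (fun y => (1 - c) * geom_slope (c * x + (1 - c) * y) y +
     c * (y - x) / (y * (y - 1))) v theta vth).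
  move=> y /andP[vy yth]; have zy := zgt1 y vy.
  have -> : G = fun y =>
    (c * x + (1 - c) * y) * ln (0 + 1 * y) +
    (c * x - 1 + (1 - c) * y) * ln (c * x - 1 + (1 - c) * y) -
    (c * x + (1 - c) * y) * ln (c * x + (1 - c) * y) -
    (c * x - 1 + (1 - c) * y) * ln (- 1 + 1 * y).
    apply/funext => u; rewrite /G /geom_rate add0r mul1r.
    by rewrite !(addrAC _ _ (-1)) (addrC (-1) u).
  have p1 : 0 < 0 + 1 * y by lra.
  have p2 : 0 < c * x - 1 + (1 - c) * y by lra.
  have p3 : 0 < c * x + (1 - c) * y by lra.
  have p4 : 0 < - 1 + 1 * y by lra.
  have d1 := @is_derive_affine_mul_ln (c * x) (1 - c) _ _ _ p1.
  have d2 := @is_derive_affine_mul_ln (c * x - 1) (1 - c) _ _ _ p2.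
  have d3 := @is_derive_affine_mul_ln (c * x) (1 - c) _ _ _ p3.
  have d4 := @is_derive_affine_mul_ln (c * x - 1) (1 - c) _ _ _ p4.
  apply: (is_derive_eq (is_deriveB (is_deriveB (is_deriveD d1 d2) d3) d4)).
  rewrite /geom_slope.
  move: p1 p2 p3 p4; rewrite add0r mul1r.
  rewrite !(addrAC _ _ (-1)) (addrC (-1) y) => p1 p2 p3 p4.
  have -> : c * x - 1 + (1 - c) * y = c * x + (1 - c) * y - 1 by ring.
  set l1 := ln y; set l2 := ln (y - 1); set l3 := ln _; set l4 := ln _.
  field.
  rewrite !gt_eqF//=; lra.
move=> y /andP[vy yth]; have zy := zgt1 y vy.
set z := c * x + (1 - c) * y in zy *.
have zle : z <= y by rewrite /z; nra.
have y1 : 0 < y - 1 by lra.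
have y0 : 0 < y by lra.
have z1 : 0 < z - 1 by lra.
have z0 : 0 < z by lra.
have h : - geom_slope z y <= (y - 1) * z / (y * (z - 1)) - 1.
  have -> : - geom_slope z y = ln ((y - 1) * z / (y * (z - 1))).
    by rewrite /geom_slope ln_div ?lnM ?posrE ?mulr_gt0//; ring.
  by rewrite ln_le_subr1// divr_gt0 ?mulr_gt0.
(* Over a common denominator the claim reduces to [(1 - c) * (y - 1) <= z - 1], which holds because
   [1 <= x]. *)
have h2 : (1 - c) * ((y - 1) * z / (y * (z - 1)) - 1) <= c * (y - x) / (y * (y - 1)).
  have -> : (1 - c) * ((y - 1) * z / (y * (z - 1)) - 1) =
            (1 - c) * (y - 1) * (y - z) / (y * (z - 1) * (y - 1)).
    by field; rewrite !gt_eqF//=; lra.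
  have -> : c * (y - x) / (y * (y - 1)) =
            (z - 1) * (y - z) / (y * (z - 1) * (y - 1)).
    have -> : y - z = c * (y - x) by rewrite /z; ring.
    by field; rewrite !gt_eqF//=; lra.
  rewrite ler_pM2r ?invr_gt0 ?mulr_gt0//.
  by apply: ler_wpM2r; rewrite ?subr_ge0// /z; nra.
have : (1 - c) * - geom_slope z y <= (1 - c) * ((y - 1) * z / (y * (z - 1)) - 1).
  by apply: ler_wpM2l => //; rewrite subr_ge0.
rewrite mulrN; lra.
Qed.
End RateFunction.

(** * Level sets of the rate, geometric likelihoods, and what stopping on the wrong side implies *)

Section Crossing.
Variable R : realType.
Implicit Types (a b c w x z theta eps : R) (m n K : nat).

Lemma continuous_geom_rate z v : 1 < z -> {for z, continuous (geom_rate R ^~ v)}.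
Proof.
move=> z1; have z0 : 0 < z by lra.
have cln : {for z, continuous (@ln R)} by exact: continuous_ln.
have cln1 : {for z, continuous (fun y : R => ln (y - 1))}.
  apply: (@continuous_comp _ _ _ (fun y : R => y - 1) (@ln R)).
    by apply: cvgB; [exact: cvg_id|exact: cvg_cst].
  by apply: continuous_ln; lra.
rewrite /geom_rate.
have cid : {for z, continuous (fun y : R => y)} by exact: cvg_id.
have cid1 : {for z, continuous (fun y : R => y - 1)}.
  by apply: cvgB; [exact: cvg_id|exact: cvg_cst].
apply: cvgB; first apply: cvgB; first apply: cvgD.
- by apply: cvgMr_tmp; exact: cid.
- by apply: cvgM; [exact: cid1|exact: cln1].
- by apply: cvgM; [exact: cid|exact: cln].
- by apply: cvgMr_tmp; exact: cid1.
Qed.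

(* If the rate at the extremum were below [b], continuity would keep it below
   [b] on a neighbourhood of the extremum. *)
Lemma geom_rate_ge_lower_threshold theta b w0 : 1 <= w0 <= theta ->
    b <= geom_rate R w0 theta ->
  exists z, [/\ 1 <= z <= theta, b <= geom_rate R z theta &
    forall w, 1 <= w <= theta -> b <= geom_rate R w theta -> w <= z].
Proof.
move=> w01 bw0.
pose Z := [set w | 1 <= w <= theta /\ b <= geom_rate R w theta].
have Z0 : Z !=set0 by exists w0.
have ubZ : ubound Z theta by move=> w [/andP[]].
have hsZ : has_sup Z by split=> //; exists theta.
have leZ w : 1 <= w <= theta -> b <= geom_rate R w theta -> w <= sup Z.
  by move=> w1 bw; apply: ub_le_sup; [exists theta|].
have supth : sup Z <= theta by apply: ge_sup.
have sup1 : 1 <= sup Z by case/andP: (w01) => ? ?; apply: le_trans (leZ _ w01 bw0).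
exists (sup Z); split=> //; first by rewrite sup1.
(* Continuity is available only at points above 1; if the supremum is 1, it is attained at [w0]. *)
have [s1|s1] := eqVneq (sup Z) 1.
  by rewrite s1; have := leZ _ w01 bw0; rewrite s1 => w0le; rewrite (_ : 1 = w0)//; lra.
have {s1}s1 : 1 < sup Z by rewrite lt_neqAle eq_sym s1.
rewrite leNgt; apply/negP => sb.
have /cvgr_lt/(_ _ sb) := continuous_geom_rate (sup Z) theta s1.
move=> -[e /= e0 He].
have [w [w1 bw] wgt] := @sup_adherent _ Z e e0 hsZ.
have wle := leZ w w1 bw.
have : geom_rate R w theta < b by apply: He; rewrite /ball_/= ger0_norm ?subr_ge0//; lra.
by rewrite ltNge bw.
Qed.

(** The infimum of the level set is at least [theta], hence above 1, so continuity applies there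
    without a boundary case. *)
Lemma geom_rate_ge_upper_threshold theta b w0 : 1 < theta -> theta <= w0 ->
    b <= geom_rate R w0 theta ->
  exists z, [/\ theta <= z, b <= geom_rate R z theta &
    forall w, theta <= w -> b <= geom_rate R w theta -> z <= w].
Proof.
move=> th1 w01 bw0.
pose Z := [set w | theta <= w /\ b <= geom_rate R w theta].
have Z0 : Z !=set0 by exists w0.
have lbZ : lbound Z theta by move=> w [].
have hsZ : has_inf Z by split=> //; exists theta.
have leZ w : theta <= w -> b <= geom_rate R w theta -> inf Z <= w.
  by move=> w1 bw; apply: ge_inf; [exists theta|].
have infth : theta <= inf Z by apply: lb_le_inf.
exists (inf Z); split=> //.
rewrite leNgt; apply/negP => sb.
have s1 : 1 < inf Z by lra.
have /cvgr_lt/(_ _ sb) := continuous_geom_rate (inf Z) theta s1.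
move=> -[e /= e0 He].
have [w [w1 bw] wgt] := @inf_adherent _ Z e e0 hsZ.
have wle := leZ w w1 bw.
have : geom_rate R w theta < b by apply: He; rewrite /ball_/= ler0_norm ?subr_le0//; lra.
by rewrite ltNge bw.
Qed.

(** The mass at [k + 1]: observations are recorded by their excess over 1. *)
Definition geom_pmf theta (k : nat) : R := theta^-1 * (1 - theta^-1) ^+ k.

(** The likelihood of [n] observations whose excesses over 1 add up to [K]. *)
Definition geom_likelihood theta n K : R := theta^-1 ^+ n * (1 - theta^-1) ^+ K.

Lemma ln_geom_likelihood theta n K : 1 < theta ->
  ln (geom_likelihood theta n K) =
  K%:R * (ln (theta - 1) - ln theta) - n%:R * ln theta.
Proof.
move=> th1; have th0 : 0 < theta by lra.
have th10 : 0 < theta - 1 by lra.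
have e : 1 - theta^-1 = (theta - 1) / theta by field; rewrite gt_eqF.
rewrite /geom_likelihood e lnM ?posrE ?exprn_gt0 ?divr_gt0 ?invr_gt0//.
rewrite !lnXn ?divr_gt0 ?invr_gt0// -[ln _ *+ n]mulr_natl -[ln _ *+ K]mulr_natl.
rewrite ln_div ?lnV ?posrE//.
by ring.
Qed.

Lemma geom_likelihood_gt0 theta n K : 1 < theta -> 0 < geom_likelihood theta n K.
Proof.
move=> th1; rewrite /geom_likelihood mulr_gt0 ?exprn_gt0 ?invr_gt0 ?subr_gt0//.
  by lra.
by rewrite invf_lt1//; lra.
Qed.

(** The partial sums telescope. The case [z = 1], a point mass at excess 0, is included because the
    extreme point of a level set can be 1. *)
Lemma sum_geom_pmf_le1 z n : 1 <= z -> \sum_(k < n) geom_pmf z k <= 1.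
Proof.
move=> z1; have z0 : 0 < z by lra.
have zi : 0 <= 1 - z^-1 by rewrite subr_ge0 invf_le1.
have -> : \sum_(k < n) geom_pmf z k = 1 - (1 - z^-1) ^+ n.
  elim: n => [|n IH]; first by rewrite big_ord0 expr0 subrr.
  by rewrite big_ord_recr/= IH /geom_pmf exprS; ring.
by rewrite gerBl exprn_ge0.
Qed.

Lemma geom_pmf_ge0 z k : 1 <= z -> 0 <= geom_pmf z k.
Proof.
move=> z1; rewrite mulr_ge0 ?invr_ge0 ?exprn_ge0//; first lra.
by rewrite subr_ge0 invf_le1//; lra.
Qed.

Lemma prod_geom_pmf z ks :
  \prod_(k <- ks) geom_pmf z k = geom_likelihood z (size ks) (sumn ks).
Proof.
rewrite /geom_likelihood; elim: ks => [|k ks IH]; first by rewrite big_nil !expr0 mulr1.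
by rewrite big_cons IH /geom_pmf/= exprS exprD; ring.
Qed.

(* The mean [w] completes the [n] observations to [maxn n m] ones, the missing
   ones being replaced by [theta]. *)
Lemma geom_likelihood_ratio_ge theta z a w m n K :
    1 < theta -> 1 <= z -> 1 <= w -> 0 <= a -> (0 < m)%N ->
    (w <= z <= theta) || (theta <= z <= w) ->
    (maxn n m)%:R * w = (n + K)%:R + ((maxn n m)%:R - n%:R) * theta ->
    m%:R^-1 * a <= geom_rate R z theta ->
  expR a * geom_likelihood theta n K <= geom_likelihood z n K.
Proof.
move=> th1 z1 w1 a0 m0 zw Nw az.
have m0R : 0 < m%:R :> R by rewrite ltr0n.
have nN : n%:R <= (maxn n m)%:R :> R by rewrite ler_nat leq_maxl.
have mN : m%:R <= (maxn n m)%:R :> R by rewrite ler_nat leq_maxr.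
have am : a <= m%:R * geom_rate R z theta.
  by rewrite -ler_pdivrMl// ltr0n.
have rate0 : 0 <= geom_rate R z theta by apply: geom_rate_ge0.
have aN : a <= (maxn n m)%:R * geom_rate R z theta.
  by apply: le_trans am _; apply: ler_wpM2r.
set N := (maxn n m)%:R in Nw nN mN aN.
rewrite natrD in Nw.
have [e1|z_neq1] := eqVneq z 1.
  rewrite e1 in zw *.
  have w_eq1 : w = 1 by move: zw => /orP[]/andP[]; lra.
  rewrite w_eq1 in Nw.
  have K0R : 0 <= K%:R :> R by rewrite ler0n.
  have Nn : N = n%:R by nra.
  have /eqP : K%:R = 0 :> R by nra.
  rewrite pnatr_eq0 => /eqP ->.
  rewrite /geom_likelihood !expr0 !mulr1 invr1 expr1n.
  rewrite exprVn ler_pdivrMr ?exprn_gt0//; last lra.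
  rewrite mul1r -[leRHS]lnK ?posrE ?exprn_gt0//; last lra.
  rewrite ler_expR lnXn; last lra.
  rewrite -mulr_natl -Nn; apply: le_trans aN _.
  by rewrite e1 /geom_rate subrr !mul0r ln1; lra.
have {z_neq1}z1 : 1 < z by rewrite lt_neqAle eq_sym z_neq1.
have L0 := @geom_likelihood_gt0 theta n K th1.
have L1 := @geom_likelihood_gt0 z n K z1.
suff : ln (expR a * geom_likelihood theta n K) <= ln (geom_likelihood z n K).
  by rewrite ler_ln// posrE mulr_gt0// expR_gt0.
rewrite lnM ?posrE ?expR_gt0// expRK.
rewrite !ln_geom_likelihood// -subr_ge0.
have KE : K%:R = N * (w - 1) - (N - n%:R) * (theta - 1) by rewrite mulrBr Nw; ring.
(* The log-likelihood ratio of the completed sample is affine in [w], with value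
   [N * geom_rate z theta] at [z]; each added copy of [theta] had contributed [- geom_rate theta z].
   All three summands are nonnegative, the second because [z] lies between [theta] and [w]. *)
have -> : K%:R * (ln (z - 1) - ln z) - n%:R * ln z -
    (a + (K%:R * (ln (theta - 1) - ln theta) - n%:R * ln theta)) =
  (N * geom_rate R z theta - a) + N * (geom_slope R z theta * (w - z)) +
  (N - n%:R) * geom_rate R theta z.
  by rewrite KE /geom_rate /geom_slope; ring.
have sw : 0 <= geom_slope R z theta * (w - z).
  case/orP : zw => /andP[? ?].
    by rewrite mulr_le0 ?geom_slope_le0//; lra.
  by rewrite mulr_ge0 ?geom_slope_ge0//; lra.
have r0 : 0 <= geom_rate R theta z by apply: geom_rate_ge0 => //; lra.
have N0 : 0 <= N by rewrite ler0n.
have T1 := mulr_ge0 N0 sw.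
have T2 : 0 <= (N - n%:R) * geom_rate R theta z by rewrite mulr_ge0// subr_ge0.
lra.
Qed.

Definition stop_stat eps m n x : \bar R :=
  M_G ((1 + eps - n%:R * eps / (maxn n m)%:R) * x) ((1 + eps) * x).

(** The first argument of [M_G] is the mean obtained by completing the sample with copies of
    [(1 + eps) * x], the observed values having total weight [c]. *)
Lemma stop_statE eps m n x : 0 < eps < 1 -> (0 < n)%N -> 1 <= x ->
  let c := n%:R / (maxn n m)%:R in
  0 < c <= 1 /\
  stop_stat eps m n x =
    (- geom_rate R (c * x + (1 - c) * ((1 + eps) * x)) ((1 + eps) * x))%:E.
Proof.
move=> /andP[e0 e1] n0 x1 c.
have N0 : 0 < (maxn n m)%:R :> R by rewrite ltr0n leq_max n0.
have c01 : 0 < c <= 1.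
  apply/andP; split; first by rewrite divr_gt0// ltr0n.
  by rewrite ler_pdivrMr// mul1r ler_nat leq_maxl.
split=> //; rewrite /stop_stat.
have -> : (1 + eps - n%:R * eps / (maxn n m)%:R) * x =
  c * x + (1 - c) * ((1 + eps) * x) by rewrite /c; field; rewrite gt_eqF.
case/andP: c01 => c0 c1.
have ex0 : 0 < eps * x by rewrite mulr_gt0//; lra.
have cex0 : 0 <= (1 - c) * (eps * x) by rewrite mulr_ge0//; lra.
by rewrite M_G_rate//; lra.
Qed.

Lemma completed_mean theta m n K : (0 < n)%N ->
  let c := n%:R / (maxn n m)%:R in
  (maxn n m)%:R * (c * ((n + K)%:R / n%:R) + (1 - c) * theta) =
  (n + K)%:R + ((maxn n m)%:R - n%:R) * theta :> R.
Proof.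
move=> n0 c; rewrite /c; field.
by rewrite !pnatr_eq0 -!lt0n leq_max n0.
Qed.

(** [geom_rate_interpolation_le] replaces the filling value [(1 + eps) * x] by the larger [theta],
    so the completed mean lies in the level set below [theta]; [z] is the largest point of that
    set. *)
Lemma geom_lower_crossing theta eps a m :
    1 < theta -> 0 < eps < 1 -> 0 <= a -> (0 < m)%N ->
  exists2 z, 1 <= z & forall n K, (0 < n)%N ->
    (1 + eps) * ((n + K)%:R / n%:R) <= theta ->
    (stop_stat eps m n ((n + K)%:R / n%:R) <= (m%:R^-1 * - a)%:E)%E ->
    expR a * geom_likelihood theta n K <= geom_likelihood z n K.
Proof.
move=> th1 e01 a0 m0; case/andP: (e01) => e0 e1.
have key n K : (0 < n)%N -> (1 + eps) * ((n + K)%:R / n%:R) <= theta ->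
    (stop_stat eps m n ((n + K)%:R / n%:R) <= (m%:R^-1 * - a)%:E)%E ->
    let w := n%:R / (maxn n m)%:R * ((n + K)%:R / n%:R) +
      (1 - n%:R / (maxn n m)%:R) * theta in
    1 <= w <= theta /\ m%:R^-1 * a <= geom_rate R w theta.
  move=> n0; set x := _ / _ => xth.
  have x1 : 1 <= x by rewrite ler_pdivlMr ?ltr0n// mul1r ler_nat leq_addr.
  have [] := @stop_statE eps m n x e01 n0 x1; set c := _ / _ => c01 ->.
  rewrite lee_fin mulrN lerN2 => am w.
  have xth' : x <= theta by nra.
  split.
    case/andP: c01 => c0 c1.
    have h1 : 0 <= c * (x - 1) by rewrite mulr_ge0; lra.
    have h2 : 0 <= (1 - c) * (theta - 1) by rewrite mulr_ge0; lra.
    have h3 : 0 <= c * (theta - x) by rewrite mulr_ge0; lra.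
    by rewrite /w; apply/andP; split; lra.
  apply: le_trans am _; apply: geom_rate_interpolation_le => //; nra.
have [[w0 [w01 bw0]]|none] := pselect (exists w0, 1 <= w0 <= theta /\
    m%:R^-1 * a <= geom_rate R w0 theta); last first.
  (* With an empty level set the premises are contradictory, and any mean serves as witness. *)
  exists theta; first exact: ltW.
  move=> n K n0 h1 h2; have [h3 h4] := key n K n0 h1 h2.
  by exfalso; apply: none; eexists; split; [exact: h3|].
have [z [/andP[z1 zth] bz zmax]] := geom_rate_ge_lower_threshold _ _ _ w01 bw0.
exists z => // n K n0 h1 h2; have [h3 h4] := key n K n0 h1 h2.
case/andP: (h3) => h31 h32.
apply: (geom_likelihood_ratio_ge _ _ _ _ _ _ _ th1 z1 h31 a0 m0 _ _ bz).
  by rewrite (zmax _ h3 h4) zth.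
exact: completed_mean.
Qed.

(** The statistic measures a downward deviation [c * (eps * x)] from [(1 + eps) * x]. By
    [geom_rate_deviation_le] the same deviation upwards from [theta] has at least that rate, and the
    completed mean lies at least as far out; [z] is the least point of the level set above
    [theta]. *)
Lemma geom_upper_crossing theta eps a m :
    1 < theta -> 0 < eps < 1 -> 0 <= a -> (0 < m)%N ->
  exists2 z, 1 <= z & forall n K, (0 < n)%N ->
    theta <= (1 - eps) * ((n + K)%:R / n%:R) ->
    (stop_stat eps m n ((n + K)%:R / n%:R) <= (m%:R^-1 * - a)%:E)%E ->
    expR a * geom_likelihood theta n K <= geom_likelihood z n K.
Proof.
move=> th1 e01 a0 m0; case/andP: (e01) => e0 e1.
have key n K : (0 < n)%N -> theta <= (1 - eps) * ((n + K)%:R / n%:R) ->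
    (stop_stat eps m n ((n + K)%:R / n%:R) <= (m%:R^-1 * - a)%:E)%E ->
    let w := n%:R / (maxn n m)%:R * ((n + K)%:R / n%:R) +
      (1 - n%:R / (maxn n m)%:R) * theta in
    theta <= w /\ m%:R^-1 * a <= geom_rate R w theta.
  move=> n0; set x := _ / _ => xth.
  have x1 : 1 <= x by rewrite ler_pdivlMr ?ltr0n// mul1r ler_nat leq_addr.
  have [] := @stop_statE eps m n x e01 n0 x1; set c := _ / _ => c01 ->.
  rewrite lee_fin mulrN lerN2 => am w.
  have ex0 : 0 < eps * x by nra.
  case/andP: c01 => c0 c1.
  have cex0 : 0 <= c * (eps * x) by nra.
  have cex1 : c * (eps * x) <= eps * x by nra.
  have thw : theta + c * (eps * x) <= w by rewrite /w; nra.
  split; first lra.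
  apply: le_trans am _.
  apply: le_trans (geom_rate_nondecreasing _ theta w (theta + c * (eps * x)) th1 _ thw); last lra.
  have -> : c * x + (1 - c) * ((1 + eps) * x) = (1 + eps) * x - c * (eps * x) by ring.
  by apply: geom_rate_deviation_le => //; nra.
have [[w0 [w01 bw0]]|none] := pselect (exists w0, theta <= w0 /\
    m%:R^-1 * a <= geom_rate R w0 theta); last first.
  exists theta; first exact: ltW.
  move=> n K n0 h1 h2; have [h3 h4] := key n K n0 h1 h2.
  by exfalso; apply: none; eexists; split; [exact: h3|].
have [z [thz bz zmin]] := geom_rate_ge_upper_threshold _ _ _ th1 w01 bw0.
have z1 : 1 <= z by lra.
exists z => // n K n0 h1 h2; have [h3 h4] := key n K n0 h1 h2.
have w1 := le_trans (ltW th1) h3.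
apply: (geom_likelihood_ratio_ge _ _ _ _ _ _ _ th1 z1 w1 a0 m0 _ _ bz).
  by rewrite thz (zmin _ h3 h4) orbT.
exact: completed_mean.
Qed.

(** At [n = m] no value is added, and the rate of [x] against [(1 + eps) * x] is at least
    [ln (1 + eps) - eps / (1 + eps)] for every [x >= 1]. This is the denominator of the sample size
    bound divided by [1 + eps]. *)
Lemma stop_stat_self_le eps m a x : 0 < eps < 1 -> (0 < m)%N ->
    (1 + eps) * a / ((1 + eps) * ln (1 + eps) - eps) <= m%:R -> 1 <= x ->
  (stop_stat eps m m x <= (m%:R^-1 * - a)%:E)%E.
Proof.
move=> e01 m0 ma x1; have [_] := @stop_statE eps m m x e01 m0 x1.
have m0R : 0 < m%:R :> R by rewrite ltr0n.
rewrite maxnn divff ?gt_eqF// subrr mul1r mul0r addr0 => ->.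
rewrite lee_fin mulrN lerN2.
case/andP: e01 => e0 e1.
have D0 : 0 < (1 + eps) * ln (1 + eps) - eps.
  have : ln (1 + eps)^-1 < (1 + eps)^-1 - 1.
    have ne : ln (1 + eps)^-1 != 0.
      by rewrite lnV ?posrE ?oppr_eq0 ?gt_eqF ?ln_gt0//; lra.
    rewrite -ltrBDr opprK -{2}(@lnK _ (1 + eps)^-1) ?posrE ?invr_gt0; last lra.
    by rewrite addrC expR_gt1Dx.
  rewrite lnV ?posrE; last lra.
  have -> : (1 + eps)^-1 - 1 = - (eps / (1 + eps)) by field; rewrite gt_eqF//; lra.
  by rewrite ltrN2 ltr_pdivrMr; lra.
have : a <= m%:R * (ln (1 + eps) - eps / (1 + eps)).
  move: ma; rewrite ler_pdivrMr// => ma.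
  rewrite -(@ler_pM2l _ (1 + eps)); last lra.
  have -> : (1 + eps) * (m%:R * (ln (1 + eps) - eps / (1 + eps))) =
    m%:R * ((1 + eps) * ln (1 + eps) - eps) by field; rewrite gt_eqF//; lra.
  exact: ma.
rewrite -ler_pdivrMl// => am; apply: le_trans am _.
have l0 : 0 <= eps / (1 + eps) by rewrite divr_ge0//; lra.
rewrite /geom_rate; have [->|xn1] := eqVneq x 1.
  by rewrite subrr ln1 !mul0r mulr1; lra.
have x10 : 0 < x - 1 by rewrite subr_gt0 lt_neqAle eq_sym xn1.
have x0 : 0 < x by lra.
(* After [ln u <= u - 1] the factor [x - 1] cancels, so the bound is free of [x]. *)
have : (x - 1) * ln (((1 + eps) * x - 1) / ((1 + eps) * (x - 1))) <= eps / (1 + eps).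
  have -> : eps / (1 + eps) = (x - 1) * (((1 + eps) * x - 1) / ((1 + eps) * (x - 1)) - 1).
    by field; rewrite !gt_eqF//; lra.
  by rewrite ler_pM2l// ln_le_subr1// divr_gt0 ?mulr_gt0//; nra.
rewrite ln_div ?lnM ?posrE ?mulr_gt0//; try nra.
Qed.
End Crossing.

(** * Ville's inequality on a tree of prefixes *)

Section Cylinders.
Context {d : measure_display} {T : measurableType d} {R : realType}.
Variables (P : probability T R) (X : nat -> {RV P >-> R}).

(** The list records excesses over 1, matching the indexing of [geom_pmf]. *)
Definition cylinder (ks : seq nat) : set T :=
  \big[setI/setT]_(i <- iota 0 (size ks)) (X i @^-1` [set (nth 0%N ks i).+1%:R]).

Definition off_support (n : nat) : set T :=
  ~` \bigcup_k (X n @^-1` [set k.+1%:R]).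

Lemma cylinderP ks w :
  cylinder ks w <-> forall i, (i < size ks)%N -> X i w = (nth 0%N ks i).+1%:R.
Proof.
rewrite /cylinder -bigcap_seq; split=> [H i ilt|H i /=].
  by apply: H; rewrite /= mem_iota.
by rewrite mem_iota/= add0n => ilt; exact: H.
Qed.

Lemma measurable_preimage1 n (r : R) : measurable (X n @^-1` [set r]).
Proof. by rewrite -[X in measurable X]setTI; exact: measurable_funPT. Qed.

Lemma measurable_cylinder ks : measurable (cylinder ks).
Proof. by apply: bigsetI_measurable => i _; exact: measurable_preimage1. Qed.

Lemma measurable_off_support n : measurable (off_support n).
Proof.
by apply: measurableC; apply: bigcupT_measurable => k; exact: measurable_preimage1.
Qed.

(* Ville's inequality for the likelihood ratio of [q'] against [q], proved by
   backward induction on the horizon: over the paths extending a given prefix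
   the crossing probability is at most the [q']-mass of that prefix over [A]. *)
Lemma likelihood_ratio_crossing (q q' : nat -> R) (A : R) (F : nat -> set T) :
    0 < A -> (forall k, 0 <= q' k) -> (forall n, \sum_(k < n) q' k <= 1) ->
    (forall ks, P (cylinder ks) = (\prod_(k <- ks) q k)%:E) ->
    (forall n, P (off_support n) = 0%E) ->
    (forall n, measurable (F n)) ->
    (forall ks, cylinder ks `&` F (size ks) !=set0 ->
      A * \prod_(k <- ks) q k <= \prod_(k <- ks) q' k) ->
  (P (\bigcup_n F n) <= (A^-1)%:E)%E.
Proof.
move=> A0 q'0 q'1 Pcyl Poff mF Fcyl.
have mU r j : measurable (\bigcup_(i in `I_r) F (j + i)%N).
  by apply: bigcup_measurable.
have prod0 ks : 0 <= \prod_(k <- ks) q' k by apply: prodr_ge0.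
have main r : forall ks,
    (P (cylinder ks `&` \bigcup_(j in `I_r) F (size ks + j)%N) <=
     (A^-1 * \prod_(k <- ks) q' k)%:E)%E.
  elim: r => [|r IH] ks.
    by rewrite II0 bigcup_set0 setI0 measure0 lee_fin mulr_ge0// invr_ge0 ltW.
  have mC := measurable_cylinder ks.
  (* A crossing anywhere on the cylinder bounds the likelihood of the whole prefix, so the
     probability of the cylinder itself is small enough. *)
  have [ne|/set0P/negP/negPn/eqP FC] := pselect (cylinder ks `&` F (size ks) !=set0).
    apply: (@le_trans _ _ (P (cylinder ks))).
      by apply: le_measure; rewrite ?inE//; apply: measurableI.
    by rewrite Pcyl lee_fin -ler_pdivrMl ?invr_gt0// invrK; exact: Fcyl.
  pose G k := cylinder (rcons ks k) `&`
    \bigcup_(j in `I_r) F (size (rcons ks k) + j)%N.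
  have mG k : measurable (G k) by apply: measurableI => //; exact: measurable_cylinder.
  have mUG : measurable (\bigcup_k G k) by exact: bigcupT_measurable.
  have mO := measurable_off_support (size ks).
  (* Without a crossing at the current length, [j = 0] is excluded; the crossing then belongs to the
     extension by the next value, with the horizon shortened by one. *)
  have sub : cylinder ks `&` \bigcup_(j in `I_r.+1) F (size ks + j)%N `<=`
      off_support (size ks) `|` \bigcup_k G k.
    move=> w [Cw [j /= jr Fw]].
    have [[k _ /= Xk]|noff] := pselect ((\bigcup_k (X (size ks) @^-1` [set k.+1%:R])) w);
      last by left.
    right; exists k => //; split.
      apply/cylinderP => i; rewrite size_rcons ltnS leq_eqVlt nth_rcons.
      have [->|ne]/= := eqVneq i (size ks); first by rewrite ltnn.
      by move=> ilt; rewrite ilt; move/cylinderP: Cw; exact.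
    case: j jr Fw => [|j] jr Fw.
      have : (cylinder ks `&` F (size ks)) w by rewrite addn0 in Fw.
      by rewrite FC.
    by exists j => //; rewrite size_rcons addSnnS.
  apply: (@le_trans _ _ (P (off_support (size ks) `|` \bigcup_k G k))).
    by apply: le_measure; rewrite ?inE//;
      [apply: measurableI => //; exact: mU|apply: measurableU].
  apply: (@le_trans _ _ (P (off_support (size ks)) + P (\bigcup_k G k))%E).
    exact: measureU2.
  rewrite Poff add0e.
  apply: (le_trans (generalized_Boole_inequality P mG mUG)).
  apply: lime_le; first by apply: is_cvg_nneseries.
  apply: nearW => n.
  apply: (@le_trans _ _ (\sum_(0 <= k < n) (A^-1 * \prod_(k <- ks) q' k * q' k)%:E)%E).
    apply: lee_sum => k _; apply: (le_trans (IH _)).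
    by rewrite lee_fin -cats1 big_cat big_seq1 mulrA.
  rewrite sumEFin lee_fin -mulr_sumr big_mkord.
  by rewrite ler_piMr// mulr_ge0// invr_ge0 ltW.
have mB r : measurable (\bigcup_(j in `I_r) F j) by apply: bigcup_measurable.
(* The bound does not depend on the horizon [r], so it passes to the limit; it is then used for the
   empty prefix. *)
have : (fun r => P (\bigcup_(j in `I_r) F j)) @ \oo --> P (\bigcup_n F n).
  have -> : \bigcup_n F n = \bigcup_r \bigcup_(j in `I_r) F j.
    apply/seteqP; split=> [w [n _ Fn]|w [r _ [j _ Fj]]]; last by exists j.
    by exists n.+1 => //; exists n => //=.
  apply: nondecreasing_cvg_mu => //; first exact: bigcupT_measurable.
  move=> r r' rr'; apply/subsetPset => w [j /= jr Fj]; exists j => //=.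
  exact: leq_trans jr rr'.
move=> cv; rewrite -(cvg_lim _ cv)//.
apply: lime_le; first by apply/cvg_ex; eexists; exact: cv.
apply: nearW => r; have := main r [::].
by rewrite /cylinder/= !big_nil setTI mulr1.
Qed.

End Cylinders.

Lemma sample_mean_support (T : Type) (R : realType) (Y : nat -> T -> R) n w (k : nat -> nat) :
    (forall i, (i < n)%N -> Y i w = (k i).+1%:R) ->
  sample_mean Y n w = (n + \sum_(i < n) k i)%:R / n%:R.
Proof.
move=> Yk; rewrite /sample_mean mulrC; congr (_ / _).
rewrite natrD natr_sum -[n in n%:R + _]card_ord -sumr_const -natr_sum.
rewrite natr_sum -big_split/=; apply: eq_bigr => i _.
by rewrite Yk// -natr1 addrC.
Qed.

(** * Cylinder probabilities and crossing bound for a geometric sample *)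

Section GeometricSample.
Context {d : measure_display} {T : measurableType d} {R : realType}.
Variables (P : probability T R) (X : nat -> {RV P >-> R}) (theta : R).
Hypothesis theta_gt1 : 1 < theta.
Hypothesis X_indep : mutually_independent P (fun i => X i : T -> R).
Hypothesis X_geom : forall i, geometric_law P theta (X i).

Lemma geometric_cylinder ks :
  P (cylinder P X ks) = (\prod_(k <- ks) geom_pmf R theta k)%:E.
Proof.
rewrite /cylinder (X_indep (iota 0 (size ks))
  (fun i => [set (nth 0%N ks i).+1%:R])) ?iota_uniq//.
rewrite [in RHS](big_nth 0%N) /index_iota subn0 -prodEFin.
by apply: eq_bigr => i _; rewrite [LHS]X_geom// subn1.
Qed.

(** The masses at the positive integers form a geometric series of sum 1, which leaves nothing
    elsewhere. *)
Lemma geometric_off_support n : P (off_support P X n) = 0%E.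
Proof.
rewrite /off_support probability_setC; last first.
  by apply: bigcupT_measurable => k; exact: measurable_preimage1.
suff -> : P (\bigcup_k (X n @^-1` [set k.+1%:R])) = 1%E by rewrite subee.
have sa : (fun N => \sum_(0 <= k < N) P (X n @^-1` [set k.+1%:R]))%E @ \oo -->
    P (\bigcup_k (X n @^-1` [set k.+1%:R])).
  apply: measure_semi_sigma_additive.
  - by move=> k; exact: measurable_preimage1.
  - apply/trivIsetP => i j _ _ ij; apply/seteqP; split=> // w [/= -> /eqP].
    by rewrite eqr_nat eqSS (negbTE ij).
  - by apply: bigcupT_measurable => k; exact: measurable_preimage1.
apply: (cvg_unique _ sa) => //.
have -> : (fun N => \sum_(0 <= k < N) P (X n @^-1` [set k.+1%:R]))%E =
    EFin \o series (geometric theta^-1 (1 - theta^-1)).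
  apply/funext => N; rewrite /= /series/= -sumEFin; apply: eq_bigr => k _.
  by rewrite [LHS]X_geom// subn1.
have th0 : 0 < theta := lt_trans ltr01 theta_gt1.
have i1 : 0 < theta^-1 < 1 by rewrite invr_gt0 th0 invf_lt1.
have -> : 1%E = (theta^-1 / (1 - (1 - theta^-1)))%:E.
  by rewrite opprB addrC subrK divff// invr_neq0// gt_eqF.
apply: cvg_EFin; first by apply: nearW.
apply: cvg_geometric_series; rewrite ger0_norm; lra.
Qed.

(** Ville's inequality at level [expR a], the alternative being the law of mean [z]. On a cylinder
    the sample mean is [(n + K) / n], where [K] is the sum of the excesses, and the likelihoods
    depend on [n] and [K] only. *)
Lemma geometric_crossing (z a : R) (F : nat -> set T) : 1 <= z ->
    (forall n, measurable (F n)) ->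
    (forall n K w, F n w -> sample_mean (fun i => X i : T -> R) n w = (n + K)%:R / n%:R ->
      expR a * geom_likelihood R theta n K <= geom_likelihood R z n K) ->
  (P (\bigcup_n F n) <= (expR (- a))%:E)%E.
Proof.
move=> z1 mF FL; rewrite expRN.
apply: (@likelihood_ratio_crossing _ _ _ P X (geom_pmf R theta) (geom_pmf R z)) => //.
- exact: expR_gt0.
- by move=> k; exact: geom_pmf_ge0.
- by move=> n; exact: sum_geom_pmf_le1.
- exact: geometric_cylinder.
- exact: geometric_off_support.
- move=> ks [w [/cylinderP Cw Fw]]; rewrite !prod_geom_pmf; apply: (FL _ _ w Fw).
  rewrite (sample_mean_support T R _ (size ks) w (nth 0%N ks))//.
  by rewrite sumnE (big_nth 0%N) big_mkord.
Qed.

End GeometricSample.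

(** * Measurability of the stopping statistic *)

Section StoppingMeasurability.
Context {d : measure_display} {T : measurableType d} {R : realType}.
Variables (P : probability T R) (X : nat -> {RV P >-> R}).
Let Xbar := sample_mean (fun i => X i : T -> R).

Lemma measurable_sample_mean n : measurable_fun setT (Xbar n).
Proof.
apply: measurable_funM => //.
by apply: (@measurable_sum _ _ _ _ _ (index_enum 'I_n) (fun i : 'I_n => X i : T -> R)).
Qed.

(** Inversion is continuous on the open complement of 0, and a single point is harmless. *)
Lemma measurable_invr : measurable_fun [set: R] (@GRing.inv R).
Proof.
rewrite -(setvU [set (0 : R)]); apply/measurable_funU => //.
  exact: measurableC.
split; last exact: measurable_fun_set1.
apply: open_continuous_measurable_fun.
  apply: closed_openC; apply: accessible_closed_set1.
  by apply: hausdorff_accessible; exact: norm_hausdorff.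
by move=> x; rewrite inE/= => /eqP; exact: inv_continuous.
Qed.

Lemma measurable_stop_stat (eps : R) m n :
  measurable_fun [set: R] (stop_stat R eps m n : R -> \bar R).
Proof.
rewrite /stop_stat /M_G.
have mc (c : R) : measurable_fun [set: R] (fun x : R => c * x).
  exact: measurable_funM.
have mV (f : R -> R) : measurable_fun setT f -> measurable_fun setT (fun x => (f x)^-1).
  by move=> mf; apply: (measurableT_comp measurable_invr mf).
have mln (f : R -> R) : measurable_fun setT f -> measurable_fun setT (fun x => ln (f x)).
  by move=> mf; apply: (measurableT_comp (@measurable_ln R) mf).
have mB (c : R) : measurable_fun [set: R] (fun x : R => 1 - c * x).
  exact: measurable_funB.
apply: measurable_fun_ifT => //.
  by apply: measurable_neg; apply: measurable_fun_ltr.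
apply: measurable_fun_ifT; first exact: measurable_fun_eqr.
  apply/measurable_EFinP; apply: measurable_funN.
  exact: mln.
apply/measurable_EFinP; apply: measurable_funD; apply: measurable_funM => //.
- by apply: mln; apply: measurable_funM => //; exact: mV.
- by apply: mln; apply: measurable_funM => //; exact: mV.
Qed.

Lemma measurable_stop_stat_le (eps : R) m n (b : \bar R) :
  measurable [set w | (stop_stat R eps m n (Xbar n w) <= b)%E].
Proof.
rewrite -[X in measurable X]setTI; apply: measurable_lee => //.
apply: (@measurableT_comp _ _ _ _ _ _ (stop_stat R eps m n)).
  exact: measurable_stop_stat.
exact: measurable_sample_mean.
Qed.

End StoppingMeasurability.

(** * The stopping time and the measurability of the estimation event *)

Section StoppingTime.
Context {d : measure_display} {T : measurableType d} {R : realType}.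
Variables (P : probability T R) (X : nat -> {RV P >-> R}).
Variables (eps delta theta : R) (s : nat) (m : nat -> nat) (N : set nat).
Let Xbar := sample_mean (fun i => X i : T -> R).
Let bn := stopping_time (fun i => X i : T -> R) eps delta s m N.
Let stops n : set T := [set w | stop_cond eps delta s m n (Xbar n w)].

Lemma stopping_time_eq w n : N n -> stops n w ->
  (forall k, N k -> stops k w -> (n <= k)%N) -> bn w = n.
Proof.
move=> Nn Sn nmin; rewrite /bn /stopping_time; set A := [set _ | _].
have An : A n by split.
have [Nx Sx xmin] := xgetI 0%N An.
by apply/eqP; rewrite eqn_leq (xmin n)//= nmin.
Qed.

(** A value other than the default 0 can only come from the defining set. *)
Lemma stopping_time_spec w : bn w <> 0%N ->
  [/\ N (bn w), stops (bn w) w & forall k, N k -> stops k w -> (bn w <= k)%N].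
Proof.
rewrite /bn /stopping_time; set A := [set _ | _] => bn0.
have [[n An]|none] := pselect (exists n, A n); first exact: xgetI An.
by exfalso; apply: bn0; apply: xgetPN => n An; apply: none; exists n.
Qed.

Lemma stopping_time_exists w k : N k -> stops k w -> N (bn w) /\ stops (bn w) w.
Proof.
move=> Nk Sk.
have ex : exists n, `[< N n /\ stops n w >] by exists k; apply/asboolP.
case: (ex_minnP ex) => n /asboolP[Nn Sn] nmin.
rewrite (@stopping_time_eq w n)// => j Nj Sj; apply: nmin; exact/asboolP.
Qed.

Lemma measurable_stops n : measurable (stops n).
Proof.
have -> : stops n = \bigcup_(l in [set l | (1 <= l <= s)%N])
    [set w | (stop_stat R eps (m l) n (Xbar n w) <=
      ((m l)%:R^-1 * ln (delta / (2 * s%:R)))%:E)%E].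
  by apply/seteqP; split=> [w [l [ls h]]|w [l ls h]]; exists l.
by apply: bigcup_measurable => l _; exact: measurable_stop_stat_le.
Qed.

Hypothesis theta_gt0 : 0 < theta.

Lemma measurable_estimate_event :
  measurable [set w | (1 - eps) * Xbar (bn w) w < theta < (1 + eps) * Xbar (bn w) w].
Proof.
pose B n := [set w | (1 - eps) * Xbar n w < theta < (1 + eps) * Xbar n w].
have mB n : measurable (B n).
  have -> : B n = [set w | (1 - eps) * Xbar n w < theta] `&`
                  [set w | theta < (1 + eps) * Xbar n w].
    by apply/seteqP; split=> w; [move=> /andP[]|move=> [h1 h2]; apply/andP].
  have mX c : measurable_fun setT (fun w => c * Xbar n w).
    by apply: measurable_funM => //; exact: measurable_sample_mean.
  by apply: measurableI; rewrite -[X in measurable X]setTI; apply: measurable_fun_ltr.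
(* The event is split by the value of the stopping time. The value 0 contributes nothing: the empty
   sample mean is 0, which contradicts [theta < (1 + eps) * 0]. *)
rewrite [X in measurable X](_ : _ = \bigcup_(n in [set n | N n /\ n <> 0%N])
  (B n `&` stops n `\` \bigcup_(k in [set k | N k /\ (k < n)%N]) stops k)).
  apply: bigcup_measurable => n _; apply: measurableD.
    by apply: measurableI => //; exact: measurable_stops.
  by apply: bigcup_measurable => k _; exact: measurable_stops.
apply/seteqP; split=> [w Bw|w [n [Nn n0] [[Bw Sw] first]]].
  have bn0 : bn w <> 0%N.
    move=> e; move: Bw => /andP[_]; rewrite e /Xbar /sample_mean big_ord0 !mulr0.
    by rewrite ltNge ltW.
  have [Nb Sb bmin] := stopping_time_spec w bn0.
  exists (bn w) => //; split=> // -[k [Nk kb] Sk].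
  by have := bmin k Nk Sk; rewrite leqNgt kb.
rewrite /= (@stopping_time_eq w n)// => k Nk Sk.
by rewrite leqNgt; apply/negP => kn; apply: first; exists k.
Qed.

End StoppingTime.

(** * Union bound over the crossing events and conclusion *)

Theorem mainTheorem4 (d : measure_display) (T : measurableType d)
  (R : realType) (P : probability T R) (theta : R) (X : nat -> {RV P >-> R})
  (eps delta : R) (s : nat) (m : nat -> nat) (N : set nat)
  (theta_gt1 : 1 < theta)
  (X_indep : mutually_independent P (fun i => X i : T -> R))
  (X_geom : forall i, geometric_law P theta (X i))
  (eps01 : 0 < eps < 1) (delta01 : 0 < delta < 1)
  (s_gt0 : (0 < s)%N)
  (m_gt0 : forall l, (1 <= l <= s)%N -> (0 < m l)%N)
  (m_incr : forall l, (1 <= l < s)%N -> (m l < m l.+1)%N)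
  (m_s_ge : (1 + eps) * ln (2 * s%:R / delta)
            / ((1 + eps) * ln (1 + eps) - eps) <= (m s)%:R)
  (N_gt0 : forall n, N n -> (0 < n)%N)
  (m_in_N : forall l, (1 <= l <= s)%N -> N (m l)) :
  let Xbar := sample_mean (fun i => X i : T -> R) in
  let bn := stopping_time (fun i => X i : T -> R) eps delta s m N in
  ((1 - delta)%:E <=
   P [set w | ((1 - eps) * Xbar (bn w) w < theta
               < (1 + eps) * Xbar (bn w) w)%R])%E.
Proof.
cbv zeta; set Xbar := sample_mean _; set bn := stopping_time _ _ _ _ _ _.
case/andP: (delta01) => delta0 delta1.
have s0 : 1 <= s%:R :> R by rewrite ler1n.
(* With this level the stopping threshold is [- a / m l], and each crossing event has probability at
   most [expR (- a) = delta / (2 * s)]. *)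
pose a := ln (2 * s%:R / delta).
have d2s0 : 0 < 2 * s%:R / delta by rewrite divr_gt0//; lra.
have a0 : 0 <= a by rewrite ln_ge0// ler_pdivlMr//; lra.
have aE : ln (delta / (2 * s%:R)) = - a by rewrite -lnV ?posrE// invf_div.
have expNa : expR (- a) = delta / (2 * s%:R).
  by rewrite -aE lnK// posrE -invf_div invr_gt0.
(* [low] and [upp] are the events that index [l] triggers stopping at [n] although [theta] lies
   beyond the upper, respectively lower, end of the interval. The conjunct [0 < n] supplies the
   premise of the crossing lemmas. *)
pose low l n := [set w | (0 < n)%N /\ (1 + eps) * Xbar n w <= theta] `&`
  [set w | (stop_stat R eps (m l) n (Xbar n w) <= ((m l)%:R^-1 * - a)%:E)%E].
pose upp l n := [set w | (0 < n)%N /\ theta <= (1 - eps) * Xbar n w] `&`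
  [set w | (stop_stat R eps (m l) n (Xbar n w) <= ((m l)%:R^-1 * - a)%:E)%E].
have mX n (c : R) : measurable_fun setT (fun w => c * Xbar n w).
  by apply: measurable_funM => //; exact: measurable_sample_mean.
have mlow l n : measurable (low l n).
  apply: measurableI; last exact: measurable_stop_stat_le.
  case: (ltnP 0%N n) => n0; last first.
    by rewrite [X in measurable X](_ : _ = set0)//; apply/seteqP; split=> w // [].
  rewrite [X in measurable X](_ : _ = [set: T] `&` [set w | (1 + eps) * Xbar n w <= theta]).
    exact: measurable_fun_ler.
  by apply/seteqP; split=> w // [].
have mupp l n : measurable (upp l n).
  apply: measurableI; last exact: measurable_stop_stat_le.
  case: (ltnP 0%N n) => n0; last first.
    by rewrite [X in measurable X](_ : _ = set0)//; apply/seteqP; split=> w // [].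
  rewrite [X in measurable X](_ : _ = [set: T] `&` [set w | theta <= (1 - eps) * Xbar n w]).
    exact: measurable_fun_ler.
  by apply/seteqP; split=> w // [].
have Plow l : (1 <= l <= s)%N -> (P (\bigcup_n low l n) <= (delta / (2 * s%:R))%:E)%E.
  move=> ls; rewrite -expNa.
  have [z z1 Hz] := geom_lower_crossing R theta eps a (m l) theta_gt1 eps01 a0 (m_gt0 l ls).
  apply: (geometric_crossing P X theta theta_gt1 X_indep X_geom z a) => //.
  move=> n K w [[n0 h1] h2]; rewrite -/(Xbar n w) => XE.
  by apply: Hz => //; rewrite -XE.
have Pupp l : (1 <= l <= s)%N -> (P (\bigcup_n upp l n) <= (delta / (2 * s%:R))%:E)%E.
  move=> ls; rewrite -expNa.
  have [z z1 Hz] := geom_upper_crossing R theta eps a (m l) theta_gt1 eps01 a0 (m_gt0 l ls).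
  apply: (geometric_crossing P X theta theta_gt1 X_indep X_geom z a) => //.
  move=> n K w [[n0 h1] h2]; rewrite -/(Xbar n w) => XE.
  by apply: Hz => //; rewrite -XE.
(* The shift to [l.+1] turns the indices 1 to [s] into the range of a big union over [l < s]. *)
pose bad l := \bigcup_n low l.+1 n `|` \bigcup_n upp l.+1 n.
have mbad l : measurable (bad l) by apply: measurableU; exact: bigcupT_measurable.
have Pbad l : (l < s)%N -> (P (bad l) <= (delta / s%:R)%:E)%E.
  move=> ls; apply: (@le_trans _ _
    (P (\bigcup_n low l.+1 n) + P (\bigcup_n upp l.+1 n))%E).
    by apply: measureU2; exact: bigcupT_measurable.
  have -> : (delta / s%:R)%:E = ((delta / (2 * s%:R))%:E + (delta / (2 * s%:R))%:E)%E.
    by rewrite -EFinD; congr EFin; field; rewrite gt_eqF//; lra.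
  by apply: leeD; [exact: Plow|exact: Pupp].
(* Outside this null set all observations are positive integers, so every nonempty sample mean is at
   least 1. *)
pose null := \bigcup_i off_support P X i.
have mnull : measurable null by apply: bigcupT_measurable; exact: measurable_off_support.
have Pnull : P null = 0%E.
  apply/eqP; rewrite eq_le measure_ge0 andbT.
  apply: (le_trans (generalized_Boole_inequality P (measurable_off_support P X) mnull)).
  rewrite eseries0// => i _ _.
  exact: (geometric_off_support P X theta theta_gt1 X_geom).
pose Bad := null `|` \big[setU/set0]_(l < s) bad l.
have mbigbad : measurable (\big[setU/set0]_(l < s) bad l) by apply: bigsetU_measurable.
have mBad : measurable Bad by apply: measurableU.
have PBad : (P Bad <= delta%:E)%E.
  apply: (@le_trans _ _ (P null + P (\big[setU/set0]_(l < s) bad l))%E).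
    exact: measureU2.
  rewrite Pnull add0e; apply: (le_trans (Boole_inequality P _)) => //.
  apply: (@le_trans _ _ (\sum_(l < s) (delta / s%:R)%:E)%E).
    by apply: lee_sum => l _; exact: Pbad.
  rewrite sumEFin lee_fin sumr_const card_ord -[_ *+ s]mulr_natr divfK//.
  by rewrite gt_eqF//; lra.
apply: (@le_trans _ _ (P (~` Bad))).
  rewrite probability_setC// EFinB; apply: leeB => //.
apply: le_measure; rewrite ?inE//.
- exact: measurableC.
- by apply: measurable_estimate_event; lra.
move=> w nBad.
have supp i : exists k, X i w = k.+1%:R.
  have [[k _ /= Xk]|no] := pselect ((\bigcup_k (X i @^-1` [set k.+1%:R])) w).
    by exists k.
  by exfalso; apply: nBad; left; exists i.
have [k Xk] := choice supp.
have mean1 n : (0 < n)%N -> 1 <= Xbar n w.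
  move=> n0; rewrite /Xbar (sample_mean_support T R _ n w k)//.
  by rewrite ler_pdivlMr ?ltr0n// mul1r ler_nat leq_addr.
have ss : (1 <= s <= s)%N by rewrite s_gt0 leqnn.
(* The stopping condition holds at [m s] through the index [s], by the lower bound on [m s]; so a
   first stopping index exists. *)
have [Nb Sb] : N (bn w) /\ stop_cond eps delta s m (bn w) (Xbar (bn w) w).
  apply: (@stopping_time_exists _ _ _ P X eps delta s m N w (m s)); first exact: m_in_N.
  exists s; split=> //; rewrite aE.
  apply: (stop_stat_self_le R eps (m s) a) => //; first exact: m_gt0.
  by apply: mean1; exact: m_gt0.
case: Sb => l' [l's]; rewrite aE => Sl'.
case: l' l's Sl' => // l /andP[_ ls] Sl.
have nbad : ~ bad l w.
  move=> bl; apply: nBad; right.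
  by rewrite -(bigcup_mkord s bad); exists l.
(* A failure of the first inequality puts [w] in [upp], and a failure of the second puts it in
   [low]. *)
apply/andP; split; rewrite ltNge; apply/negP => h; apply: nbad.
  by right; exists (bn w) => //; split=> //; split=> //; exact: N_gt0.
by left; exists (bn w) => //; split=> //; split=> //; exact: N_gt0.
Qed.
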